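(* Let $\Xi$ be the search space for an instance $I_{BERT}$ of the optimal subarchitecture extraction problem for BERT architectures of the form $$b(x; W; \xi) = \mathbf{p}(\mathbf{l}_{D-1}(\cdots(\mathbf{l}_{0}(\mathbf{i}(x)))\cdots)),$$ where $b \in B$ is parametrized by some $\xi = \langle D, A, H, I\rangle \in \Xi$ whose variable set encodes the depth $D$, number of attention heads $A$, hidden size $H$, and intermediate size $I$. Suppose that for all $\xi \in \Xi$ the depth $D$ in $\xi$ is even, that the possible weight assignments $W$ belong to a compact set, and that the surrogate error function is $L$-Lipschitz smooth with respect to $W$ (for some $L$), is bounded from below, and has bounded stochastic gradients. Then $I_{BERT}$ presents the strong $AB^nC$ property.
   Context: **BERT architectures.** Let $V$ be a finite vocabulary of non-negative integers (its cardinality is also denoted $V$) and $s$ the sequence length; an input is a vector $x$ of length $s$ with entries in $V$. $\Xi$ is a finite set of tuples $\xi=\langle D,A,H,I\rangle$ of positive integers with $A$ dividing $H$. $B$ is the family of architectures obtained as $\xi$ ranges over $\Xi$. Intermediate representations have one $H$-dimensional (or $I$-dimensional) vector per sequence position. $W_{m,n}$ denotes a trainable linear layer $y\mapsto Wy+b$ (distinct occurrences have distinct trainable parameters; applied at each position), $R$ a dropout layer (sets each entry to $0$ with some probability $\pi$, leaves it unchanged otherwise), $N(y)=\frac{y-\mathbb{E}[y]}{\sqrt{\mathrm{Var}[y]+\epsilon}}\alpha+\beta$ layer normalization with trainable $\alpha,\beta$ and a constant $\epsilon>0$, and $\mathbf{s}$ the softmax. The layers are: - input (embedding) layer: $\mathbf{i}(x)=N(R(V[x]+V'[x']+V''[x'']))$,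 where $x',x''$ are position and token type indices of $x$ and $V[\cdot],V'[\cdot],V''[\cdot]$ are trainable lookup tables; - encoder layers: $\mathbf{l}_j(x)=N(R(W_{I,H}(\mathrm{GeLU}(W_{H,I}(\mathbf{m}(x))))+\mathbf{m}(x)))$, with $\mathbf{m}(x)=N(R(W_{H,H}(R(\mathbf{a}(x))))+x)$ and attention $\mathbf{a}(x)=\mathbf{s}\!\left(\frac{W_{H,H}(x)W_{H,H}^{\top}(x)}{\sqrt{H/A}}\right)W_{H,H}(x)$ (the three $W_{H,H}$ being the query, key and value layers); - output (pooler) layer: $\mathbf{p}(x)=\tanh(W_{H,H}(x))$. $W$ denotes the collection of all trainable parameters. **Parameter size and inference speed.** For a network or part of a network $f$, $\mathcal{p}(f)$ is its number of trainable parameters and $\mathcal{i}(f)$ its inference cost, measured by the number of FLOPs (add-multiply operations) $[f]$. With $V$ and $S$ (size of the auxiliary embedding table) treated as constants, $\mathcal{p}(b)=D(4H^2+2HI+9H+I)+H^2+(V+S+6)H$, where each encoder layer contributes $4H^2+2HI+9H+I$, the pooler contributes $H^2+H$, and the embedding layer the remaining $(V+S+5)H$; and $[b]=D(4(2H-1)H+H^2+(2H-1)I+7I^2)+(2H-1)H+3H$, where each encoder layer contributes $4(2H-1)H+H^2+(2H-1)I+7I^2$, the pooler $(2H-1)H$ and the embedding layer $3H$. These are regarded as polynomials in the variables of $\xi$. **Weak $AB^nC$ property.** A network $f$ has the weak $AB^nC$ property if it can be written as $f(x)=C(B_{n-1}(\cdots B_0(A(x))\cdots))$ for some $n\ge 1$,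 where $A$, $C$ are layers and each $B_j$ is a layer or a composition of consecutive layers, such that for every $j$, both $\mathcal{p}(A)\in o(\mathcal{p}(B_j))$, $\mathcal{p}(C)\in o(\mathcal{p}(B_j))$ and $\mathcal{i}(A)\in o(\mathcal{i}(B_j))$, $\mathcal{i}(C)\in o(\mathcal{i}(B_j))$, asymptotically in the variables of $\xi$. **Optimal subarchitecture extraction problem.** An instance consists of the family $B$ parametrized by the search space $\Xi$, a set of possible weight assignments, a dataset, and a surrogate error function $\hat{\mathcal{e}}$ (a loss depending on $b(\cdot;W;\xi)$ and hence on $W$); the task is to find $\xi\in\Xi$ whose architecture is optimal jointly with respect to parameter size, inference speed and error rate. **Strong $AB^nC$ property.** An instance has the strong $AB^nC$ property if its architectures have the weak $AB^nC$ property and its surrogate error function is $L$-Lipschitz smooth with respect to $W$, bounded from below, and has bounded stochastic gradients. **$L$-Lipschitz smooth** means differentiable with $L$-Lipschitz gradient. *)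

(* Defs.v *)
From HB Require Import structures.
From mathcomp Require Import all_boot all_order all_algebra finmap.
From mathcomp Require Import all_classical all_reals all_analysis.
From mathcomp Require Import lra zify.

Set Implicit Arguments.
Unset Strict Implicit.
Unset Printing Implicit Defensive.

Import Order.TTheory GRing.Theory Num.Theory.
Import numFieldNormedType.Exports.

Local Open Scope classical_set_scope.
Local Open Scope ring_scope.

(* A tuple <D, A, H, I>, stored as ((D, A), (H, I)). *)
Definition config := ((nat * nat) * (nat * nat))%type.
Definition depth (xi : config) : nat := xi.1.1.
Definition heads (xi : config) : nat := xi.1.2.
Definition hidden (xi : config) : nat := xi.2.1.
Definition inter (xi : config) : nat := xi.2.2.

Definition admissible (xi : config) : bool :=
  [&& 0 < depth xi, 0 < heads xi, 0 < hidden xi, 0 < inter xi &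
      heads xi %| hidden xi]%N.

(* All four variables tend to infinity, jointly and with no relation imposed
   between their rates, along the admissible tuples. *)
Definition config_infty : set_system config :=
  within [set xi | admissible xi]
    (filter_prod (filter_prod \oo \oo) (filter_prod \oo \oo)).

Global Instance config_infty_filter : Filter config_infty.
Proof. exact: within_filter. Qed.

Canonical config_infty_filter_on :=
  @FilterType config config_infty config_infty_filter.

(* This filter is proper, so that asymptotic statements along it are not
   vacuous. *)
Lemma config_infty_proper : ProperFilter config_infty.
Proof.
apply: Build_ProperFilter_ex => P.
case=> -[/= Q Q'] [[[/= a b] [[na _ Ha] [nb _ Hb]] Q1]
  [[/= c d] [[nc _ Hc] [nd _ Hd]] Q2]] sub.
pose A := nb.+1; pose H := (nc.+1 * A)%N.
exists ((na.+1, A), (H, nd.+1)); apply: sub.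
  split => /=.
    by apply: Q1; split; [exact: Ha (leqnSn _)|exact: Hb (leqnSn _)].
  apply: Q2; split; last exact: Hd (leqnSn _).
  by apply: Hc; rewrite /= /H /A; nia.
by rewrite /= /admissible /depth /heads /hidden /inter /= dvdn_mull.
Qed.

(* A layer with input in T and output in U; P collects what the layer reads
   besides its input (weights, dropout outcomes). *)
Record layer (P T U : Type) := Layer {
  lay_fun : P -> T -> U;
  lay_size : nat;
  lay_flops : nat
}.

Definition comp_fun (P U : Type) (b : seq (layer P U U)) (p : P) (x : U) : U :=
  foldl (fun y l => lay_fun l p y) x b.
Definition comp_size (P U : Type) (b : seq (layer P U U)) : nat :=
  (\sum_(l <- b) lay_size l)%N.
Definition comp_flops (P U : Type) (b : seq (layer P U U)) : nat :=
  (\sum_(l <- b) lay_flops l)%N.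

(* [net_rest] lists the layers after the first in order of application. *)
Record network (P T U : Type) := Network {
  net_first : layer P T U;
  net_rest : seq (layer P U U)
}.

Definition net_fun (P T U : Type) (f : network P T U) (p : P) (x : T) : U :=
  comp_fun (net_rest f) p (lay_fun (net_first f) p x).
Definition net_size (P T U : Type) (f : network P T U) : nat :=
  (lay_size (net_first f) + comp_size (net_rest f))%N.
Definition net_flops (P T U : Type) (f : network P T U) : nat :=
  (lay_flops (net_first f) + comp_flops (net_rest f))%N.

(* The number n of blocks is fixed for the whole family. A finite search space
   leaves no room for asymptotics, so the decomposition is a rule defined for
   every admissible tuple, and sizes and costs are compared as functions of the
   tuple. *)
Definition weak_ABnC (R : realType) (P T U : config -> Type)
    (f : forall xi, network (P xi) (T xi) (U xi)) : Prop :=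
  exists n : nat, (0 < n)%N /\
  exists (A : forall xi, layer (P xi) (T xi) (U xi))
         (B : forall xi, 'I_n -> seq (layer (P xi) (U xi) (U xi)))
         (C : forall xi, layer (P xi) (U xi) (U xi)),
    (forall xi, admissible xi ->
      [/\ forall j, (0 < size (B xi j))%N,
          net_first (f xi) = A xi,
          net_rest (f xi) = flatten [seq B xi j | j <- enum 'I_n] ++ [:: C xi] &
          forall p x, net_fun (f xi) p x =
            lay_fun (C xi) p
              (foldl (fun y j => comp_fun (B xi j) p y)
                 (lay_fun (A xi) p x) (enum 'I_n))]) /\
    (forall j : 'I_n,
      let pB := fun xi => (comp_size (B xi j))%:R : R in
      let iB := fun xi => (comp_flops (B xi j))%:R : R in
      [/\ (fun xi => (lay_size (A xi))%:R : R) =o_config_infty pB,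
          (fun xi => (lay_size (C xi))%:R : R) =o_config_infty pB,
          (fun xi => (lay_flops (A xi))%:R : R) =o_config_infty iB &
          (fun xi => (lay_flops (C xi))%:R : R) =o_config_infty iB]).

(* Index types of trainable parameters: [inl] indexes the entries of the matrix
   (or scale), [inr] those of the bias (or shift). A lookup table is the linear
   layer applied to one-hot vectors, hence carries a bias; with it the embedding
   layer has (V + S + 5) H parameters, S being the number of rows of the two
   auxiliary tables together. *)
Definition linear_ix (m n : nat) := ('I_n * 'I_m + 'I_n)%type.
Definition lookup_ix (T : finType) (h : nat) := (T * 'I_h + 'I_h)%type.
Definition norm_ix (h : nat) := ('I_h + 'I_h)%type.

Section Blocks.
Variable R : realType.

(* Matrices of size s x h hold one h-dimensional vector per position (row). *)
Definition linear_layer (s m n : nat) (w : linear_ix m n -> R) (y : 'M[R]_(s, m))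
    : 'M[R]_(s, n) :=
  \matrix_(t, i) (\sum_j w (inl (i, j)) * y t j + w (inr i)).

Definition lookup (T : finType) (s h : nat) (w : lookup_ix T h -> R)
    (x : 'I_s -> T) : 'M[R]_(s, h) :=
  \matrix_(t, k) (w (inl (x t, k)) + w (inr k)).

Definition feat_mean (h : nat) (y : 'I_h -> R) : R := (\sum_k y k) / h%:R.
Definition feat_var (h : nat) (y : 'I_h -> R) : R :=
  feat_mean (fun k => (y k - feat_mean y) ^+ 2).

Definition layer_norm (eps : R) (s h : nat) (w : norm_ix h -> R)
    (y : 'M[R]_(s, h)) : 'M[R]_(s, h) :=
  \matrix_(t, k) ((y t k - feat_mean (y t)) / Num.sqrt (feat_var (y t) + eps)
                  * w (inl k) + w (inr k)).

(* [drop t k] is the outcome of the draw for entry (t, k): true if erased. *)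
Definition dropout (s h : nat) (drop : 'I_s -> 'I_h -> bool) (y : 'M[R]_(s, h))
    : 'M[R]_(s, h) :=
  \matrix_(t, k) (if drop t k then 0 else y t k).

Definition softmax (m n : nat) (y : 'M[R]_(m, n)) : 'M[R]_(m, n) :=
  \matrix_(t, k) (expR (y t k) / \sum_l expR (y t l)).

Definition gelu (x : R) : R :=
  x * fine (normal_prob (0 : R) 1 `]-oo, x]).

Definition tanh (x : R) : R :=
  (expR x - expR (- x)) / (expR x + expR (- x)).

Definition attention (s h a : nat) (wq wk wv : linear_ix h h -> R)
    (x : 'M[R]_(s, h)) : 'M[R]_(s, h) :=
  softmax ((Num.sqrt (h%:R / a%:R))^-1 *:
           (linear_layer wq x *m (linear_layer wk x)^T)) *m linear_layer wv x.

(* Coordinates with respect to the standard basis. *)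
Definition gradient (n : nat) (f : 'rV[R]_n -> R) (W : 'rV[R]_n) : 'rV[R]_n :=
  \row_i 'D_(delta_mx 0 i) f W.

End Blocks.

(* The data common to all architectures of the family. *)
Record bert_model (R : realType) := BertModel {
  vocab : {fset nat};
  seqlen : nat;
  npos : nat;
  ntype : nat;
  pos_index : {ffun 'I_seqlen -> vocab} -> 'I_seqlen -> 'I_npos;
  type_index : {ffun 'I_seqlen -> vocab} -> 'I_seqlen -> 'I_ntype;
  norm_eps : R;
  norm_eps_gt0 : 0 < norm_eps;
  drop_prob : R;
  drop_prob_ge0 : 0 <= drop_prob;
  drop_prob_le1 : drop_prob <= 1
}.

Section Bert.
Variables (R : realType) (M : bert_model R).
Implicit Type xi : config.

Local Notation s := (seqlen M).

Definition input : Type := {ffun 'I_s -> vocab M}.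
Definition repr xi : Type := 'M[R]_(s, hidden xi).

Definition emb_ix xi :=
  (lookup_ix (vocab M) (hidden xi) + lookup_ix 'I_(npos M) (hidden xi)
   + lookup_ix 'I_(ntype M) (hidden xi) + norm_ix (hidden xi))%type.

(* The four square linear layers are query, key, value and attention output;
   the two normalizations are that of m and that of l_j. *)
Definition enc_ix xi :=
  ('I_4 * linear_ix (hidden xi) (hidden xi) + 'I_2 * norm_ix (hidden xi)
   + linear_ix (hidden xi) (inter xi) + linear_ix (inter xi) (hidden xi))%type.

Definition pool_ix xi := linear_ix (hidden xi) (hidden xi).

Definition param_ix xi :=
  (emb_ix xi + 'I_(depth xi) * enc_ix xi + pool_ix xi)%type.

(* The collection W of all trainable parameters, as a vector of a normed
   space. *)
Definition weights xi := 'rV[R]_(#|{: param_ix xi}|).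
Definition weight xi (W : weights xi) (i : param_ix xi) : R := W 0 (enum_rank i).

(* One dropout draw per entry: one dropout occurrence in the embedding layer
   and three in each encoder layer (on the attention, in m, and in l_j). *)
Definition site xi :=
  ('I_s * 'I_(hidden xi) + 'I_(depth xi) * 'I_3 * ('I_s * 'I_(hidden xi)))%type.

Definition env xi : Type := (weights xi * (site xi -> bool))%type.

Definition embedding xi (e : env xi) (x : input) : repr xi :=
  let w := fun i : emb_ix xi => weight e.1 (inl (inl i)) in
  layer_norm (norm_eps M) (fun i => w (inr i))
    (dropout (fun t k => e.2 (inl (t, k)))
       (lookup (fun i => w (inl (inl (inl i)))) x
        + lookup (fun i => w (inl (inl (inr i)))) (pos_index x)
        + lookup (fun i => w (inl (inr i))) (type_index x))).

Section Encoder.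
Variables (xi : config) (e : env xi) (j : 'I_(depth xi)).

Let w (i : enc_ix xi) : R := weight e.1 (inl (inr (j, i))).
Let wlin (c : 'I_4) i := w (inl (inl (inl (c, i)))).
Let wnorm (c : 'I_2) i := w (inl (inl (inr (c, i)))).
Let drop (c : 'I_3) t k := e.2 (inr (j, c, (t, k))).

Definition enc_attention (x : repr xi) : repr xi :=
  attention (heads xi) (wlin (inord 0)) (wlin (inord 1)) (wlin (inord 2)) x.

Definition enc_mid (x : repr xi) : repr xi :=
  layer_norm (norm_eps M) (wnorm (inord 0))
    (dropout (drop (inord 1))
       (linear_layer (wlin (inord 3))
          (dropout (drop (inord 0)) (enc_attention x))) + x).

Definition encoder (x : repr xi) : repr xi :=
  layer_norm (norm_eps M) (wnorm (inord 1))
    (dropout (drop (inord 2))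
       (linear_layer (fun i => w (inr i))
          (map_mx (@gelu R)
             (linear_layer (fun i => w (inl (inr i))) (enc_mid x)))
        + enc_mid x)).

End Encoder.

Definition pooler xi (e : env xi) (x : repr xi) : repr xi :=
  map_mx (@tanh R) (linear_layer (fun i => weight e.1 (inr i)) x).

(* b(x; W; xi) = p(l_{D-1}(... (l_0(i(x))) ...)), given the dropout outcomes. *)
Definition bert xi (e : env xi) (x : input) : repr xi :=
  pooler e (foldl (fun y j => encoder e j y) (embedding e x)
              (enum 'I_(depth xi))).

Definition emb_layer xi : layer (env xi) input (repr xi) :=
  Layer (@embedding xi) #|{: emb_ix xi}| (3 * hidden xi)%N.

Definition enc_layer xi (j : 'I_(depth xi)) : layer (env xi) (repr xi) (repr xi) :=
  let H := hidden xi in let I := inter xi in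
  Layer (fun e => encoder e j) #|{: enc_ix xi}|
    (4 * (2 * H - 1) * H + H ^ 2 + (2 * H - 1) * I + 7 * I ^ 2)%N.

Definition pool_layer xi : layer (env xi) (repr xi) (repr xi) :=
  Layer (@pooler xi) #|{: pool_ix xi}| ((2 * hidden xi - 1) * hidden xi)%N.

Definition bert_net xi : network (env xi) input (repr xi) :=
  Network (emb_layer xi)
    ([seq enc_layer j | j <- enum 'I_(depth xi)] ++ [:: pool_layer xi]).

Lemma bert_netE xi (e : env xi) (x : input) : net_fun (bert_net xi) e x = bert e x.
Proof.
rewrite /net_fun /comp_fun /bert /= foldl_cat /=; congr pooler.
by elim: (enum _) (embedding e x) => //= j l IH y; rewrite IH.
Qed.

Lemma card_emb_ix xi :
  #|{: emb_ix xi}| = ((#|` vocab M| + (npos M + ntype M) + 5) * hidden xi)%N.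
Proof.
rewrite /emb_ix !(card_sum, card_prod, card_ord) -cardfE.
by move: (hidden xi) #|` vocab M| => h v; lia.
Qed.

Lemma card_enc_ix xi :
  let H := hidden xi in let I := inter xi in
  #|{: enc_ix xi}| = (4 * H ^ 2 + 2 * H * I + 9 * H + I)%N.
Proof. by rewrite /enc_ix !(card_sum, card_prod, card_ord) /=; lia. Qed.

Lemma card_pool_ix xi : #|{: pool_ix xi}| = (hidden xi ^ 2 + hidden xi)%N.
Proof. by rewrite /pool_ix !(card_sum, card_prod, card_ord); lia. Qed.

Lemma bert_sizeE xi :
  let D := depth xi in let H := hidden xi in let I := inter xi in
  net_size (bert_net xi) =
  (D * (4 * H ^ 2 + 2 * H * I + 9 * H + I) + H ^ 2
   + (#|` vocab M| + (npos M + ntype M) + 6) * H)%N.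
Proof.
rewrite /net_size /comp_size /= big_cat big_map big_seq1 /= big_enum /=.
rewrite sum_nat_const card_ord card_enc_ix card_emb_ix card_pool_ix.
by move: (hidden xi) #|` vocab M| => h v; lia.
Qed.

Lemma bert_flopsE xi :
  let D := depth xi in let H := hidden xi in let I := inter xi in
  net_flops (bert_net xi) =
  (D * (4 * (2 * H - 1) * H + H ^ 2 + (2 * H - 1) * I + 7 * I ^ 2)
   + (2 * H - 1) * H + 3 * H)%N.
Proof.
rewrite /net_flops /comp_flops /= big_cat big_map big_seq1 /= big_enum /=.
by rewrite sum_nat_const card_ord; lia.
Qed.

(* The dropout draws of one stochastic evaluation: a family of independent
   Bernoulli variables, with fresh ones for each network input. *)
Definition drops xi : finType := {ffun (input * site xi)%type -> bool}.
Definition drops_prob xi (om : drops xi) : R :=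
  \prod_i (if om i then drop_prob M else 1 - drop_prob M).

Definition bert_drop xi (W : weights xi) (om : drops xi) (x : input) : repr xi :=
  bert (W, fun i => om (x, i)) x.

(* An instance of the optimal subarchitecture extraction problem. The loss sees
   the weights only through the network function b(.; W; xi). *)
Record ose_instance := OSEInstance {
  search_space : {fset config};
  search_admissible : forall xi, xi \in search_space -> admissible xi;
  weight_set : forall xi, set (weights xi);
  sample : Type;
  nsamples : nat;
  dataset : 'I_nsamples -> sample;
  loss : forall xi, (input -> repr xi) -> sample -> R
}.

Section Instance.
Variable P : ose_instance.

Definition sample_loss xi (i : 'I_(nsamples P)) (om : drops xi) (W : weights xi) : R :=
  loss (bert_drop W om) (dataset i).

(* Average over the dataset of the expected loss over the dropout draws. *)
Definition surrogate xi (W : weights xi) : R :=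
  (\sum_i \sum_om drops_prob om * sample_loss i om W) / (nsamples P)%:R.

(* Norms are those of the library (max norm on coordinates); as L and the bound
   on the gradients are existentially quantified, another norm on the finitely
   many spaces involved gives the same notions. *)
Definition lipschitz_smooth : Prop :=
  exists L : R, forall xi, xi \in search_space P ->
    (forall W, weight_set P W -> differentiable (@surrogate xi) W) /\
    L.-lipschitz_(weight_set P (xi := xi)) (gradient (@surrogate xi)).

Definition bounded_below : Prop :=
  exists c : R, forall xi, xi \in search_space P ->
    forall W : weights xi, weight_set P W -> c <= surrogate W.

(* A stochastic gradient is the gradient of the loss at one sample, for one
   outcome of the dropout layers. *)
Definition bounded_stochastic_gradients : Prop :=
  exists G : R, forall xi, xi \in search_space P ->
    forall (W : weights xi) (i : 'I_(nsamples P)) (om : drops xi),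
      weight_set P W -> 0 < drops_prob om ->
      differentiable (sample_loss i om) W /\
      `|gradient (sample_loss i om) W| <= G.

Definition strong_ABnC : Prop :=
  [/\ weak_ABnC R bert_net, lipschitz_smooth, bounded_below
    & bounded_stochastic_gradients].

End Instance.

End Bert.

(* Main.v *)
Require Import Defs.
From mathcomp Require Import all_boot all_order all_algebra finmap.
From mathcomp Require Import all_classical all_reals all_analysis.
From mathcomp Require Import zify.
Import Order.TTheory GRing.Theory Num.Theory.
Import numFieldNormedType.Exports.

Local Open Scope classical_set_scope.

(** The decomposition has a single block, the composition of all [D] encoder
    layers. One encoder layer already dominates the embedding and pooler layers
    up to a constant factor, in size and in cost, so the block of [D] of them
    wins by a factor proportional to [D], which tends to infinity. *)

(** The witness constrains only the depth factor of the product filter; admissibility comes from the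
    restriction [within]. *)
Lemma near_admissible_depth (N : nat) :
  \forall xi \near config_infty, admissible xi /\ (N <= depth xi)%N.
Proof.
exists ([set p : nat * nat | (N <= p.1)%N], [set: _]); last first.
  by move=> [[D A] [H I]] [/= ? _] ?; split.
split=> /=; last exact: filterT.
exists ([set k | (N <= k)%N], [set: _]); last by move=> [D A] [/= ? _].
by split=> /=; [exists N | exact: filterT].
Qed.

(** Where [g] is nonzero, [f / g] is at most [K / depth xi], which tends to 0; the product form
    avoids division by [g]. *)
Lemma littleo_of_depth_mul_le (R : realType) (f g : config -> nat) (K : nat) :
  (forall xi, admissible xi -> depth xi * f xi <= K * g xi)%N ->
  (fun xi => (f xi)%:R%R : R) =o_config_infty (fun xi => (g xi)%:R%R : R).
Proof.
move=> fg; apply/eqoP => e e0.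
have [N KN] : exists N : nat, (K%:R / e < N%:R)%R.
  exists (Num.bound (K%:R / e)%R).
  by apply: archi_boundP; rewrite divr_ge0 ?(ltW e0).
(* The successor makes the depth positive as well as larger than [K / e]. *)
apply: filterS (near_admissible_depth N.+1) => xi [adm ND].
rewrite !normr_nat.
have D0 : (0 < (depth xi)%:R :> R)%R by rewrite ltr0n; apply: leq_ltn_trans ND.
rewrite -(ler_pM2l D0) -natrM.
apply: (@le_trans _ _ (K%:R * (g xi)%:R)%R); first by rewrite -natrM ler_nat fg.
rewrite mulrA ler_wpM2r // -ler_pdivrMr //.
by apply: le_trans (ltW KN) _; rewrite ler_nat ltnW.
Qed.

Lemma bert_weak_ABnC (R : realType) (M : bert_model R) :
  weak_ABnC R (@bert_net R M).
Proof.
pose B xi (_ : 'I_1) := [seq @enc_layer R M xi j | j <- enum 'I_(depth xi)].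
have B_size xi j : comp_size (B xi j) =
    (depth xi * (4 * hidden xi ^ 2 + 2 * hidden xi * inter xi
                 + 9 * hidden xi + inter xi))%N.
  by rewrite /comp_size big_map big_enum /= sum_nat_const card_ord card_enc_ix.
have B_flops xi j : comp_flops (B xi j) =
    (depth xi * (4 * (2 * hidden xi - 1) * hidden xi + hidden xi ^ 2
                 + (2 * hidden xi - 1) * inter xi + 7 * inter xi ^ 2))%N.
  by rewrite /comp_flops big_map big_enum /= sum_nat_const card_ord.
have enum1 : enum 'I_1 = [:: ord0] by rewrite enum_ordSl enum_ord0.
exists 1; split => //.
exists (fun xi => emb_layer M xi), B, (fun xi => pool_layer M xi); split.
- move=> xi /and5P[D0 _ _ _ _]; split => //.
  + by move=> j; rewrite size_map size_enum_ord.
  + by rewrite enum1 /= cats0.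
  + by move=> p x; rewrite enum1 /net_fun /= /comp_fun foldl_cat.
- move=> j /=; split.
  (* The constant is the coefficient of [hidden xi] in the embedding size; one encoder layer has at
     least [9 * hidden xi] parameters. *)
  + apply: (@littleo_of_depth_mul_le _ _ _
      (#|` vocab M| + (npos M + ntype M) + 5)) => xi _.
    rewrite B_size card_emb_ix mulnCA leq_mul2l; apply/orP; right.
    by rewrite leq_mul2l; apply/orP; right; lia.
  + apply: (@littleo_of_depth_mul_le _ _ _ 1) => xi _.
    rewrite B_size card_pool_ix mul1n leq_mul2l; apply/orP; right; lia.
  (* The embedding costs [3 * hidden xi], and [hidden xi] is at most the summand [hidden xi ^ 2] of
     an encoder layer's cost. *)
  + apply: (@littleo_of_depth_mul_le _ _ _ 3) => xi /and5P[_ _ H0 _ _].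
    rewrite B_flops mulnCA !leq_mul2l /=; apply/orP; right; nia.
  + apply: (@littleo_of_depth_mul_le _ _ _ 1) => xi _.
    rewrite B_flops mul1n leq_mul2l; apply/orP; right.
    (* The pooler's cost is exactly one of the four equal copies in the leading term of an encoder
       layer's cost. *)
    by rewrite -(mulnA 4) (mulSn 3) -!addnA leq_addr.
Qed.

Theorem corollary1 (R : realType) (M : bert_model R) (P : ose_instance M) :
  (forall xi : config, xi \in search_space P -> ~~ odd (depth xi)) ->
  (forall xi : config, xi \in search_space P -> compact (@weight_set R M P xi : set (weights M xi))) ->
  lipschitz_smooth P ->
  bounded_below P ->
  bounded_stochastic_gradients P ->
  strong_ABnC P.
Proof.
(* The analytic conjuncts are assumed; what remains concerns only sizes and costs over all
   admissible tuples. *)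
by move=> _ _ smooth bounded grads; split => //; apply: bert_weak_ABnC.
Qed.
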